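(* Let $X$ be a real Banach space with norm $\|\cdot\|$, let $C^0([0,1];X)$ be the space of continuous mappings from $[0,1]$ to $X$, and let $\Phi:X\to\mathbb{R}$ be a locally Lipschitz functional. For $z_0,z_1\in X$ define $$\Gamma:=\{c\in C^0([0,1];X): c(0)=z_0,\ c(1)=z_1\},\qquad \gamma:=\inf_{c\in\Gamma}\max_{0\le t\le 1}\Phi(c(t)),$$ and set $\Phi_\gamma:=\{x\in X:\Phi(x)\ge\gamma\}$. Let $F\subset X$ be a closed and norm-bounded subset such that $F\cap\Phi_\gamma$ separates $z_0$ and $z_1$. If $\Phi$ satisfies the $(CPS)_{F,\gamma}$ condition, then there exists a critical point $\bar x\in F$ of $\Phi$ with critical value $\gamma$, i.e. $\bar x\in F$, $\Phi(\bar x)=\gamma$ and $0\in\partial\Phi(\bar x)$.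
   Context: $d(x,F):=\inf_{y\in F}\|x-y\|$ is the norm distance from $x$ to $F$. For a locally Lipschitz $\Phi:X\to\mathbb{R}$, the generalized directional derivative at $x$ along $v$ is $\Phi^0(x,v):=\limsup_{w\to x,\ t\downarrow 0}\frac{\Phi(w+tv)-\Phi(w)}{t}$, and the Clarke generalized gradient is $\partial\Phi(x):=\{x^*\in X^*:\langle x^*,v\rangle\le\Phi^0(x,v)\ \forall v\in X\}$; $\|y^*\|$ for $y^*\in X^*$ is the dual norm. $\Phi$ satisfies the $(CPS)_{F,c}$ condition if every sequence $\{x_n\}\subset X$ with $d(x_n,F)\to 0$, $\Phi(x_n)\to c$ and $(1+\|x_n\|)\min_{y^*\in\partial\Phi(x_n)}\|y^*\|\to 0$ has a (norm-)convergent subsequence. A closed set $H\subset X$ separates $z_0$ and $z_1$ if $z_0,z_1\in X\setminus H$ lie in different connected components of $X\setminus H$ (equivalently, $X\setminus H=\Omega_0\cup\Omega_1$ with $\Omega_0,\Omega_1$ disjoint open sets, $z_0\in\Omega_0$, $z_1\in\Omega_1$). *)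

(* Defs.v *)
From HB Require Import structures.
From mathcomp Require Import all_boot all_order all_algebra.
From mathcomp Require Import all_classical all_reals all_analysis.

Set Implicit Arguments.
Unset Strict Implicit.
Unset Printing Implicit Defensive.

Import Order.TTheory GRing.Theory Num.Theory.
Import numFieldNormedType.Exports.

Local Open Scope classical_set_scope.
Local Open Scope ring_scope.

(* Least and greatest element of a set of reals (0 when there is none). *)
Definition set_min (R : realType) (A : set R) : R := xget 0 (A `&` lbound A).
Definition set_max (R : realType) (A : set R) : R := xget 0 (A `&` ubound A).

Lemma set_minE (R : realType) (A : set R) (m : R) :
  A m -> lbound A m -> set_min A = m.
Proof.
move=> Am lm; apply: xget_unique => [|y [Ay ly]]; first by split.
by apply: le_anti; rewrite ly// lm.
Qed.

Lemma set_maxE (R : realType) (A : set R) (m : R) :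
  A m -> ubound A m -> set_max A = m.
Proof.
move=> Am um; apply: xget_unique => [|y [Ay uy]]; first by split.
by apply: le_anti; rewrite uy// um.
Qed.

(* The infimum is real-valued, hence 0 for the empty set F. *)
Definition dist (R : realType) (X : normedModType R) (x : X) (F : set X) : R :=
  inf [set `|x - y| | y in F].

Definition locally_lipschitz (R : realType) (X : normedModType R)
    (Phi : X -> R) : Prop :=
  forall x : X, exists2 U : set X, nbhs x U & [lipschitz (Phi y : R^o) | y in U].

(* The limit superior over the product filter "w -> x and t -> 0, t > 0"; it is
   an extended real, finite when Phi is locally Lipschitz. *)
Definition clarke_derivative (R : realType) (X : normedModType R)
    (Phi : X -> R) (x v : X) : \bar R :=
  limf_esup (fun p : X * R => ((Phi (p.1 + p.2 *: v) - Phi p.1) / p.2)%:E)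
    (filter_prod (nbhs x) (0 : R)^'+).

(* Elements of the dual X^* are the continuous linear maps from X to R. *)
Definition clarke_gradient (R : realType) (X : normedModType R)
    (Phi : X -> R) (x : X) : set {linear X -> R^o} :=
  [set f : {linear X -> R^o} | continuous f /\
     forall v : X, ((f v : R)%:E <= clarke_derivative Phi x v)%E].

Definition dual_norm (R : realType) (X : normedModType R)
    (f : {linear X -> R^o}) : R :=
  sup [set `|f v| | v in [set v : X | `|v| <= 1]].

Definition CPS (R : realType) (X : normedModType R)
    (Phi : X -> R) (F : set X) (c : R) : Prop :=
  forall x : nat -> X,
    dist (x n) F @[n --> \oo] --> (0 : R) ->
    Phi (x n) @[n --> \oo] --> c ->
    (1 + `|x n|) * set_min [set dual_norm f | f in clarke_gradient Phi (x n)]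
      @[n --> \oo] --> (0 : R) ->
    exists phi : nat -> nat, increasing_seq phi /\ cvgn (x \o phi).

Definition separates (R : realType) (X : normedModType R)
    (H : set X) (z0 z1 : X) : Prop :=
  [/\ closed H, ~ H z0, ~ H z1 &
      connected_component (~` H) z0 <> connected_component (~` H) z1].

(* A path is a map on R, continuous on [0, 1]; its values elsewhere are
   irrelevant. *)
Definition paths (R : realType) (X : normedModType R) (z0 z1 : X) :
    set (R -> X) :=
  [set c : R -> X | [/\ {within `[0, 1], continuous c}, c 0 = z0 & c 1 = z1]].

Definition minimax (R : realType) (X : normedModType R)
    (Phi : X -> R) (z0 z1 : X) : R :=
  inf [set set_max [set Phi (c t) | t in `[0, 1]] | c in paths z0 z1].

Definition superlevel (R : realType) (X : normedModType R)
    (Phi : X -> R) (a : R) : set X := [set x | a <= Phi x].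

(* Main.v *)
(* Since [F] is bounded, the weight [1 + |x|] in (CPS) is harmless, and it is
   enough to find, for every [e > 0], a point [x] within [e] of
   [H = F `&` superlevel Phi gamma], with [Phi x] in [[gamma, gamma + e^2/2]], at
   which no unit direction has generalized derivative below [-2e]; Hahn-Banach
   then gives a Clarke subgradient of norm at most [2e] at [x].

   Put [psi = max(0, e^2 - e d(., H))]. Every path meets [H], so [Phi + psi]
   reaches [gamma + e^2] on it. On the paths along which
   [Phi <= gamma + e^2/2], an Ekeland-type argument yields a path whose maximum
   of [Phi + psi] cannot be lowered by [e h] with a displacement of at most [h].
   At a maximum point [psi > 0], so the point is close to [H]. If every such
   point had a descent direction of slope [-2e], gluing these directions with a
   partition of unity on [0, 1] would lower [Phi] by [2eh] and raise [psi] by at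
   most [eh], a contradiction. *)

Require Import Defs.
From HB Require Import structures.
From mathcomp Require Import all_boot all_order all_algebra.
From mathcomp Require Import all_classical all_reals all_analysis.
From mathcomp Require Import ring lra.

Set Implicit Arguments.
Unset Strict Implicit.
Unset Printing Implicit Defensive.

Import Order.TTheory GRing.Theory Num.Theory.
Import numFieldNormedType.Exports.

Local Open Scope classical_set_scope.
Local Open Scope ring_scope.

(** * Sublinear functionals and a Hahn-Banach theorem *)

Definition sublinear (R : realType) (V : lmodType R) (p : V -> R) : Prop :=
  (forall x y, p (x + y) <= p x + p y) /\
  (forall (t : R) x, 0 < t -> p (t *: x) <= t * p x).

Section Sublinear.
Variables (R : realType) (V : lmodType R).
Implicit Types p q : V -> R.

(** The inequality of [sublinear], applied to [t^-1] and [t *: x], is the reverse one; infima thus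
    have only one direction to check. *)
Lemma sublinearZ p (t : R) x : sublinear p -> 0 < t -> p (t *: x) = t * p x.
Proof.
move=> [_ pZ] t0; apply/eqP; rewrite eq_le pZ//=.
rewrite -ler_pdivlMl//.
have := pZ t^-1 (t *: x); rewrite invr_gt0 => /(_ t0).
by rewrite scalerA mulVf ?gt_eqF// scale1r.
Qed.

Lemma sublinear0 p : sublinear p -> p 0 = 0.
Proof.
move=> sp; have := sublinearZ 0 sp (ltr0Sn R 1).
by rewrite scaler0; lra.
Qed.

Lemma sublinear_geN p x : sublinear p -> - p (- x) <= p x.
Proof.
move=> sp; have := sp.1 x (- x); rewrite subrr sublinear0//; lra.
Qed.

(** The bound depends on [q] alone, so pointwise infima of families below [q] are finite. *)
Lemma inf_family_lbound p q x : sublinear p -> (forall v, p v <= q v) ->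
  - q (- x) <= p x.
Proof.
move=> sp pq; apply: le_trans (sublinear_geN x sp).
by rewrite lerN2.
Qed.

(* Descending towards [p (x + t y) - t p y] is what makes a minimal sublinear
   functional additive. *)
Lemma minimal_sublinear_additive p : sublinear p ->
  (forall q, sublinear q -> (forall v, q v <= p v) -> q = p) ->
  forall x y, p (x + y) = p x + p y.
Proof.
move=> sp pmin x y; apply/eqP; rewrite eq_le sp.1/=.
pose E z := [set p (z + t *: y) - t * p y | t in [set t : R | 0 <= t]].
pose q z := inf (E z).
have lbE z : lbound (E z) (- p (- z)).
  move=> _ [t t0 <-].
  have [->|tn0] := eqVneq t 0.
    by rewrite scale0r addr0 mul0r subr0 sublinear_geN.
  have tgt : 0 < t by rewrite lt_def tn0.
  have := sp.1 (z + t *: y) (- z).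
  rewrite addrAC subrr add0r sublinearZ//; lra.
have E0 z : E z !=set0 by exists (p (z + 0 *: y) - 0 * p y); exists 0 => /=.
have qle z t : 0 <= t -> q z <= p (z + t *: y) - t * p y.
  by move=> t0; apply: ge_inf; [exists (- p (- z))|exists t].
have qle0 z : q z <= p z.
  by apply: le_trans (qle z 0 _) _ => //; rewrite scale0r addr0 mul0r subr0.
have sq : sublinear q.
  split => [u v|t u t0].
    rewrite -lerBlDl; apply: lb_le_inf => // _ [t /= t0 <-].
    rewrite lerBlDl -lerBlDr; apply: lb_le_inf => // _ [s /= s0 <-].
    rewrite lerBlDr; apply: le_trans (qle _ (s + t) _) _; first by rewrite addr_ge0.
    have := sp.1 (u + s *: y) (v + t *: y).
    by rewrite addrACA -scalerDl; lra.
  rewrite mulrC -ler_pdivrMr//; apply: lb_le_inf => // _ [s /= s0 <-].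
  rewrite ler_pdivrMr//; apply: le_trans (qle _ (t * s) _) _.
    by rewrite mulr_ge0// ltW.
  by rewrite -scalerA -scalerDr sublinearZ//; lra.
(* By minimality [q] is [p] itself, and its bound at [t = 1] is the missing inequality. *)
have := qle x 1 ler01; rewrite (pmin _ sq qle0) scale1r mul1r; lra.
Qed.

Lemma minimal_sublinear_exists q : sublinear q ->
  exists p, [/\ sublinear p, forall v, p v <= q v &
    forall r, sublinear r -> (forall v, r v <= p v) -> r = p].
Proof.
move=> sq.
pose T := {p : V -> R | sublinear p /\ forall v, p v <= q v}.
(* The order is reversed: the maximal element given by Zorn is a minimal functional. *)
pose le (a b : T) : bool := `[< forall v, sval b v <= sval a v >].
have [||||[p [sp pq]] /= pmin] := @Zorn T le.
- by move=> a; apply/asboolP.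
- move=> a b c /asboolP ab /asboolP bc; apply/asboolP => v.
  exact: le_trans (bc v) (ab v).
- move=> [a Ha] [b Hb] /asboolP/= ab /asboolP/= ba.
  have eab : a = b by apply/funext => v; apply/eqP; rewrite eq_le ab ba.
  by subst b; congr exist; exact: Prop_irrelevance.
- move=> A Atot.
  have [A0|A0] := pselect (exists a, A a); last first.
    by exists (exist _ q (conj sq (fun v => lexx (q v)))) => a Aa; case: A0; exists a.
  have [a0 Aa0] := A0.
  pose E z := [set sval a z | a in A].
  have lbE z : lbound (E z) (- q (- z)).
    by move=> _ [[a [sa aq]] Aa <-] /=; exact: inf_family_lbound.
  have E0 z : E z !=set0 by exists (sval a0 z); exists a0.
  pose p z := inf (E z).
  have ple z a : A a -> p z <= sval a z.
    by move=> Aa; apply: ge_inf; [exists (- q (- z))|exists a].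
  have pq v : p v <= q v.
    by apply: le_trans (ple v _ Aa0) _; case: (a0) => ? [].
  have sp : sublinear p.
    split => [u v|t u t0].
      rewrite -lerBlDl; apply: lb_le_inf => // _ [b Ab <-].
      rewrite lerBlDl -lerBlDr; apply: lb_le_inf => // _ [a Aa <-].
      rewrite lerBlDr.
      (* In a chain both infima can be tested on the smaller of the two functionals, whose own
         subadditivity then suffices. *)
      have [/asboolP ab|/asboolP ba] := Atot _ _ Aa Ab.
        apply: le_trans (ple _ _ Ab) _; case: (b) ab => /= b' [sb' _] ab.
        by apply: le_trans (sb'.1 _ _) _; rewrite lerD2r.
      apply: le_trans (ple _ _ Aa) _; case: (a) ba => /= b' [sb' _] ab.
      by apply: le_trans (sb'.1 _ _) _; rewrite lerD2l.
    rewrite mulrC -ler_pdivrMr//; apply: lb_le_inf => // _ [a Aa <-].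
    rewrite ler_pdivrMr//; apply: le_trans (ple _ _ Aa) _.
    by case: (a) => a' [sa' _] /=; rewrite mulrC sublinearZ.
  exists (exist _ p (conj sp pq)) => a Aa; apply/asboolP => v /=.
  exact: ple.
exists p; split => // r sr rp.
have rq v : r v <= q v by exact: le_trans (rp v) (pq v).
have := pmin (exist _ r (conj sr rq)).
have -> : le (exist _ p (conj sp pq)) (exist _ r (conj sr rq)) by apply/asboolP.
by move=> /(_ isT) [].
Qed.

(** A minimal sublinear functional below [q] is additive, hence odd, hence homogeneous for scalars
    of either sign. *)
Theorem sublinear_dominates_linear q : sublinear q ->
  exists f : {linear V -> R^o}, forall v, (f v : R) <= q v.
Proof.
move=> /minimal_sublinear_exists[p [sp pq pmin]].
have pD := minimal_sublinear_additive sp pmin.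
have pN x : p (- x) = - p x.
  by apply/eqP; rewrite -subr_eq0 opprK -pD addNr sublinear0.
have pZ (t : R) x : p (t *: x) = t * p x.
  have [t0|t0|->] := ltgtP t 0.
  - by rewrite -[t *: x]opprK -scaleNr pN sublinearZ ?oppr_gt0// mulNr opprK.
  - exact: sublinearZ.
  - by rewrite scale0r mul0r sublinear0.
pose g : V -> R^o := p.
have lg : linear g by move=> t x y; rewrite /g pD pZ.
pose m := GRing.isLinear.Build R V R^o *:%R g lg.
pose f : {linear V -> R^o} := HB.pack g m.
by exists f.
Qed.

End Sublinear.

(* The Clarke derivative at [x] along [v] is the infimum of these [r]. *)
Definition slope_ub (R : realType) (X : normedModType R) (Phi : X -> R)
    (x v : X) (r : R) : Prop :=
  \forall w \near x & t \near (0 : R)^'+, Phi (w + t *: v) - Phi w <= r * t.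

(** * Slope bounds and small Clarke subgradients *)

Section Clarke.
Variables (R : realType) (X : normedModType R) (Phi : X -> R).
Implicit Types (x v : X) (r e : R).

(** The limit superior is an infimum of suprema over members of the filter, and a real bound of such
    a supremum is a slope bound once the quotient is multiplied by [t > 0]. *)
Lemma slope_ub_le_clarke x v a :
  (forall r, slope_ub Phi x v r -> a <= r) ->
  (a%:E <= clarke_derivative Phi x v)%E.
Proof.
move=> ale; rewrite /clarke_derivative limf_esupE; apply: le_ereal_inf_tmp.
move=> _ [A FA <-]; set s := ereal_sup _.
have sub r : (s <= r%:E)%E -> a <= r.
  move=> sr; apply: ale; rewrite /slope_ub.
  have F2 : (\forall w \near x & t \near (0 : R)^'+, 0 < t).
    exists (setT, [set t | 0 < t]) => //=; last by case=> ? ? [].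
    by split; [exact: filterT|exact: nbhs_right_gt].
  apply: filterS (filterI FA F2) => -[w t] /= [Awt t0].
  rewrite -ler_pdivrMr// -lee_fin; apply: le_trans sr.
  by apply: ereal_sup_ubound; exists (w, t).
(* A supremum equal to [-oo] would make [a - 1] a slope bound. *)
case: s sub => [s||] sub.
- by rewrite lee_fin sub.
- by rewrite leey.
- by exfalso; have := sub (a - 1); rewrite leNye => /(_ isT); lra.
Qed.

Lemma slope_ub0 x : slope_ub Phi x 0 0.
Proof.
exists (setT, setT); first by split; exact: filterT.
by move=> [w t] _ /=; rewrite scaler0 addr0 mul0r subrr.
Qed.

Lemma slope_ubZ x v r (s : R) : 0 < s ->
  slope_ub Phi x v r -> slope_ub Phi x (s *: v) (s * r).
Proof.
move=> s0 [[A B] /= [Ax B0] AB].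
exists (A, [set t | B (s * t)]) => /=; last first.
  move=> [w t] /= [Aw Bt]; have := AB (w, s * t) (conj Aw Bt) => /=.
  by rewrite scalerA (mulrC t) mulrA (mulrC s r).
split => //; have [d /= d0 dB] := B0.
near=> t; apply: dB => /=; last by rewrite mulr_gt0.
rewrite sub0r normrN gtr0_norm ?mulr_gt0// -ltr_pdivlMl//.
by near: t; apply: nbhs_right_lt; rewrite mulr_gt0 ?invr_gt0.
Unshelve. all: by end_near. Qed.

(** The step along [v'] starts at [w + t *: v], which is still close to [x] for small [t]. *)
Lemma slope_ubD x v v' r r' :
  slope_ub Phi x v r -> slope_ub Phi x v' r' ->
  slope_ub Phi x (v + v') (r + r').
Proof.
move=> [[A B] /= [Ax B0] AB] [[A' B'] /= [Ax' B0'] AB'].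
have [d /= d0 dA] := (nbhs_ballP x A').1 Ax'.
exists (A `&` ball x (d / 2), (B `&` B') `&` [set t | 0 < t /\ t * `|v| < d / 2]) => /=.
  split; first by apply: filterI => //; apply: nbhsx_ballx; rewrite divr_gt0.
  apply: filterI; first exact: filterI.
  near=> t; have t0 : 0 < t by near: t; exact: nbhs_right_gt.
  split => //.
  have v1 : 0 < `|v| + 1 by rewrite ltr_wpDl.
  apply: (@le_lt_trans _ _ (t * (`|v| + 1))).
    by rewrite ler_wpM2l ?lerDl// ltW.
  by rewrite -ltr_pdivlMr//; near: t; apply: nbhs_right_lt; rewrite !divr_gt0.
move=> [w t] /= [[Aw xw] [[Bt Bt'] [t0 tv]]].
have := AB (w, t) (conj Aw Bt); have := AB' (w + t *: v, t); rewrite /=.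
have Aw' : A' (w + t *: v).
  apply: dA; move: xw; rewrite -!ball_normE /= => xw.
  rewrite opprD addrA; apply: le_lt_trans (ler_normB _ _) _.
  by rewrite normrZ gtr0_norm//; lra.
by move=> /(_ (conj Aw' Bt')); rewrite scalerDr addrA; lra.
Unshelve. all: by end_near. Qed.

(** This is the upper semicontinuity of the Clarke derivative in the base point: [w] already ranges
    over a neighbourhood. *)
Lemma slope_ub_near x v r : slope_ub Phi x v r ->
  \forall y \near x, slope_ub Phi y v r.
Proof.
move=> [[A B] /= [Ax B0] AB].
apply: filterS (nbhs_interior Ax) => y Ay.
by exists (A, B).
Qed.

(* A linear functional below the inf-convolution of the Clarke derivative with
   [e * norm] lies below both of them; the hypothesis makes it finite. *)
Lemma clarke_gradient_small x e : 0 <= e ->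
  (forall v r, slope_ub Phi x v r -> - (e * `|v|) <= r) ->
  exists2 f, clarke_gradient Phi x f & forall v, `|f v : R| <= e * `|v|.
Proof.
move=> e0 He.
pose E v := [set z | exists w r, slope_ub Phi x w r /\ z = r + e * `|w - v|].
pose q v := inf (E v).
have lbE v : lbound (E v) (- (e * `|v|)).
  move=> _ [w [r [/He wr ->]]].
  have : e * `|w| <= e * (`|w - v| + `|v|).
    by rewrite ler_wpM2l// -{1}(subrK v w) ler_normD.
  by rewrite mulrDr; lra.
have E0 v : E v !=set0.
  by exists (0 + e * `|0 - v|), 0, 0; split => //; exact: slope_ub0.
have qle v w r : slope_ub Phi x w r -> q v <= r + e * `|w - v|.
  by move=> wr; apply: ge_inf; [exists (- (e * `|v|))|exists w, r].
have sq : sublinear q.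
  split => [u v|t u t0].
    rewrite -lerBlDl; apply: lb_le_inf => // _ [w [r [wr ->]]].
    rewrite lerBlDl -lerBlDr; apply: lb_le_inf => // _ [w' [r' [wr' ->]]].
    rewrite lerBlDr; apply: le_trans (qle _ _ _ (slope_ubD wr wr')) _.
    have : e * `|w + w' - (u + v)| <= e * (`|w - v| + `|w' - u|).
      rewrite ler_wpM2l// (addrC u) opprD addrACA; exact: ler_normD.
    by rewrite mulrDr; lra.
  rewrite mulrC -ler_pdivrMr//; apply: lb_le_inf => // _ [w [r [wr ->]]].
  rewrite ler_pdivrMr//; apply: le_trans (qle _ _ _ (slope_ubZ t0 wr)) _.
  by rewrite -scalerBr normrZ gtr0_norm//; lra.
have [f fq] := sublinear_dominates_linear sq.
(* The infimum is tested at [w = 0] here, and at [w = v] below for the Clarke derivative. *)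
have fle v : (f v : R) <= e * `|v|.
  apply: le_trans (fq v) _; apply: le_trans (qle v _ _ (slope_ub0 x)) _.
  by rewrite add0r sub0r normrN.
have fnorm v : `|f v : R| <= e * `|v|.
  rewrite ler_norml fle andbT.
  have := fle (- v); rewrite normrN linearN /=.
  by rewrite lerNl.
exists f => //; split.
  apply/linear_bounded_continuous/bounded_funP => r; exists (e * r) => y yr.
  by apply: le_trans (fnorm y) _; rewrite ler_wpM2l.
move=> v; apply: slope_ub_le_clarke => r vr.
apply: le_trans (fq v) _; apply: le_trans (qle _ _ _ vr) _.
by rewrite subrr normr0 mulr0 addr0.
Qed.

Lemma dual_norm_ge0 (f : {linear X -> R^o}) : 0 <= dual_norm f.
Proof.
rewrite /dual_norm; set A := [set _ | _ in _].
have [hs|hs] := pselect (has_sup A); last by rewrite sup_out.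
apply: ub_le_sup; first by case: hs.
by exists 0; [rewrite /= normr0|rewrite linear0 normr0].
Qed.

Lemma min_dual_norm_le x e : 0 <= e ->
  (forall v r, slope_ub Phi x v r -> - (e * `|v|) <= r) ->
  0 <= set_min [set dual_norm f | f in clarke_gradient Phi x] <= e.
Proof.
move=> e0 /(clarke_gradient_small e0)[f fx fe].
(* Without a least element [set_min] is 0 and both bounds are immediate. *)
rewrite /set_min; case: xgetP => [y _ [[g gx <-] lby]|_]; last by rewrite lexx.
rewrite dual_norm_ge0/=; apply: le_trans (lby (dual_norm f) _) _.
  by exists f.
apply: ge_sup => [|_ [v /= v1 <-]].
  by exists `|f 0|, 0; rewrite //= normr0.
by apply: le_trans (fe v) _; rewrite -[leRHS]mulr1 ler_wpM2l.
Qed.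

End Clarke.

(** * The Brezis-Browder ordering principle *)

Section Minimal.
Variables (R : realType) (T : Type) (le : T -> T -> Prop) (I : T -> R) (m : R).
Hypotheses (le_refl : forall x, le x x)
  (le_tr : forall y x z, le x y -> le y z -> le x z)
  (I_mono : forall x y, le y x -> I y <= I x)
  (I_lb : forall x, m <= I x)
  (le_seq : forall u : nat -> T, (forall n, le (u n.+1) (u n)) ->
    exists x, forall n, le x (u n)).

(** A descending sequence that nearly exhausts the possible decrease of [I] has a lower bound [x]; a
    further decrease below [x] would force infinitely many drops of a fixed size. *)
Lemma brezis_browder (x0 : T) :
  exists x, le x x0 /\ forall y, le y x -> I y = I x.
Proof.
pose b x := inf [set I y | y in [set y | le y x]].
have bne x : [set I y | y in [set y | le y x]] !=set0 by exists (I x), x.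
have blb x : has_lbound [set I y | y in [set y | le y x]].
  by exists m => _ [y _ <-].
have ble x y : le y x -> b x <= I y.
  by move=> yx; apply: ge_inf => //; exists y.
(* Lower [I] by at least half of what is possible below [x]. *)
have /choice[f fP] x : exists y, le y x /\ 2 * I y <= I x + b x.
  have [bI|Ib] := ltP (b x) (I x); last by exists x; split => //; lra.
  have /(inf_lt (bne x)) : b x < (I x + b x) / 2 by lra.
  by case=> _ [y /= yx <-] ylt; exists y; split => //; lra.
pose u n := iter n f x0.
have uS n : le (u n.+1) (u n) by case: (fP (u n)).
have [x xu] := le_seq uS.
exists x; split; first exact: (xu 0%N).
move=> y yx; apply/eqP; rewrite eq_le I_mono//=.
(* Since [y] is also below [u n], half of the possible decrease is at least [I x - I y]. *)
have step n : I x - I y <= I (u n) - I (u n.+1).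
  have := ble _ _ (le_tr yx (xu n)); have := I_mono (xu n.+1).
  by have [_] := fP (u n); rewrite -/(u n.+1) /=; lra.
have tele n : n%:R * (I x - I y) <= I (u 0%N) - I (u n).
  elim: n => [|n IH]; first by rewrite mul0r subrr.
  by rewrite -natr1 mulrDl mul1r; have := step n; lra.
rewrite -subr_le0 leNgt; apply/negP => xy.
pose k := (Num.trunc ((I (u 0%N) - m) / (I x - I y))).+1.
have := tele k; rewrite leNgt => /negP; apply.
apply: (@le_lt_trans _ _ (I (u 0%N) - m)); first by rewrite lerD2l lerN2.
by rewrite -ltr_pdivrMr// truncnS_gt.
Qed.

End Minimal.

(** * A partition of unity on the unit interval *)

Section Hats.
Variable R : realType.
Implicit Types x t : R.

Definition clamp x : R := Num.min 1 (Num.max 0 x).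

(* Written as a difference so that the hats telescope to a partition of unity. *)
Definition hat (N i : nat) t : R :=
  clamp (N%:R * t - i%:R + 1) - clamp (N%:R * t - i%:R).

Lemma clamp_continuous : continuous clamp.
Proof.
move=> x; apply: continuous_min; first exact: cst_continuous.
apply: continuous_max; [exact: cst_continuous|exact: cvg_id].
Qed.

Lemma hat_continuous N i : continuous (hat N i).
Proof.
move=> x; apply: cvgB.
  apply: (continuous_comp (f := fun t => N%:R * t - i%:R + 1));
    last exact: clamp_continuous.
  apply: cvgD; last exact: cvg_cst.
  by apply: cvgB; [apply: cvgMl_tmp; exact: cvg_id|exact: cvg_cst].
apply: (continuous_comp (f := fun t => N%:R * t - i%:R));
  last exact: clamp_continuous.
by apply: cvgB; [apply: cvgMl_tmp; exact: cvg_id|exact: cvg_cst].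
Qed.

Lemma clamp_le0 x : x <= 0 -> clamp x = 0.
Proof. by move=> x0; rewrite /clamp max_l// min_r. Qed.

Lemma clamp_ge1 x : 1 <= x -> clamp x = 1.
Proof. by move=> x1; rewrite /clamp max_r ?(le_trans ler01)// min_l. Qed.

Lemma clamp_homo : {homo clamp : x y / x <= y}.
Proof.
move=> x y xy; rewrite /clamp le_min ge_min lexx/= ge_min ge_max.
by rewrite !le_max lexx xy/= !orbT.
Qed.

Lemma hat_ge0 N i t : 0 <= hat N i t.
Proof. by rewrite subr_ge0; apply: clamp_homo; lra. Qed.

Lemma hat_supp N i t : hat N i t != 0 -> `|N%:R * t - i%:R| < 1.
Proof.
apply: contraR; rewrite -leNgt; set x := _ - _ => x1; rewrite /hat -/x.
have [xpos|xneg] := leP 0 x.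
  by rewrite ger0_norm// in x1; rewrite !clamp_ge1 ?subrr//; lra.
by rewrite ltr0_norm// in x1; rewrite !clamp_le0 ?subrr//; lra.
Qed.

Lemma sum_hat N t : 0 <= t <= 1 -> \sum_(i < N.+1) hat N i t = 1.
Proof.
move=> /andP[t0 t1].
have tele k : \sum_(i < k) hat N i t = clamp (N%:R * t + 1) - clamp (N%:R * t - k%:R + 1).
  elim: k => [|k IH]; first by rewrite big_ord0 subr0 subrr.
  rewrite big_ord_recr/= IH /hat.
  have -> : N%:R * t - k.+1%:R + 1 = N%:R * t - k%:R by rewrite -natr1; ring.
  by ring.
(* The first clamp is 1 because [t >= 0]; the last, with [k = N.+1], is 0 because [t <= 1]. *)
rewrite tele clamp_ge1 ?clamp_le0 ?subr0//.
  have : N%:R * t <= N%:R by rewrite ler_piMr.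
  by rewrite -natr1; lra.
by rewrite lerDr mulr_ge0.
Qed.

Lemma sum_hat_continuous (X : normedModType R) N (v : nat -> X) m :
  continuous (fun t => \sum_(k < m) hat N k t *: v k).
Proof.
elim: m => [|m IH] t.
  by under eq_fun do rewrite big_ord0; exact: cvg_cst.
under eq_fun do rewrite big_ord_recr /=.
by apply: cvgD; [exact: IH|apply: cvgZr_tmp; exact: hat_continuous].
Qed.

End Hats.

(** * Continuity on the unit interval in epsilon-delta form *)

Section Paths.
Variables (R : realType) (X : normedModType R).
Implicit Types (c : R -> X).

Lemma within01P c : {within `[0, 1], continuous c} <->
  forall s, 0 <= s <= 1 -> forall e, 0 < e -> exists2 d, 0 < d &
    forall u, 0 <= u <= 1 -> `|u - s| < d -> `|c u - c s| < e.
Proof.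
rewrite subspace_continuousP; split => [cc s s01 e e0|H s /=].
  have /cc/cvgrPdist_lt/(_ e e0) : `[0, 1]%classic s by rewrite /= in_itv.
  case=> d /= d0 dP; exists d => // u u01 us.
  by rewrite distrC; apply: dP => /=; [rewrite distrC|rewrite in_itv].
rewrite in_itv /= => s01; apply/cvgrPdist_lt => e e0.
have [d d0 dP] := H s s01 e e0.
exists d => //= u /= us; rewrite in_itv /= => u01.
by rewrite distrC; apply: dP => //; rewrite distrC.
Qed.

End Paths.

(** * Deforming a path along descent directions *)

Section Perturbation.
Variables (R : realType) (X : normedModType R) (Phi psi : X -> R) (e a : R).
Hypotheses (Phi_cont : continuous Phi) (e_gt0 : 0 < e)
  (psi_lip : forall x y, psi x <= psi y + e * `|x - y|).

(* The steps [l k *: v k] are taken one after the other, each starting within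
   [d] of [x]: this spares the convexity of the Clarke derivative. *)
Lemma descent_along_sum (x : X) (d : R) (N : nat) (l : nat -> R)
    (low : pred nat) (v : nat -> X) :
  0 < d ->
  (forall k, (k < N)%N -> 0 <= l k) ->
  \sum_(k < N) l k <= 1 ->
  (forall k, low k -> v k = 0) ->
  (forall k, (k < N)%N -> ~~ low k -> l k != 0 -> `|v k| <= 1 /\
    forall w t, `|w - x| <= d -> 0 < t <= d ->
      Phi (w + t *: v k) - Phi w <= - (2 * e) * t) ->
  let th := \sum_(k < N | ~~ low k) l k in
  let y := x + d *: \sum_(k < N) l k *: v k in
  Phi y <= Phi x - 2 * e * d * th /\ `|y - x| <= d * th.
Proof.
move=> d0 l0 sl1 lowv vP /=.
suff H n : (n <= N)%N ->
    let th := \sum_(k < n | ~~ low k) l k in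
    let y := x + d *: \sum_(k < n) l k *: v k in
    Phi y <= Phi x - 2 * e * d * th /\ `|y - x| <= d * th by exact: H.
elim: n => [_|n IH nN] /=.
  by rewrite !big_ord0 scaler0 addr0 !mulr0 subr0 subrr normr0.
have [IH1 IH2] := IH (ltnW nN).
rewrite big_ord_recr /= scalerDr addrA scalerA.
rewrite [\sum_(k < n.+1 | _) _]big_mkcond big_ord_recr -big_mkcond /=.
set th := \sum_(k < n | ~~ low k) l k in IH1 IH2 *.
set y := x + _ in IH1 IH2 *.
case: (boolP (low n)) => [ln|nl] /=.
  by rewrite lowv// scaler0 !addr0.
have [ln0|ln0] := eqVneq (l n) 0.
  by rewrite ln0 mulr0 scale0r !addr0.
have [v1 vd] := vP n nN nl ln0.
have lpos : 0 < l n by rewrite lt_def ln0 l0.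
(* Partial weights of at most 1 keep the current point [y] within [d] of [x] and the next step
   [d * l n] below [d], as the descent hypothesis requires. *)
have ln_le : th + l n <= 1.
  apply: le_trans sl1; apply: (@le_trans _ _ (\sum_(k < n.+1) l k)).
    rewrite big_ord_recr /= lerD2r /th big_mkcond /=.
    by apply: ler_sum => i _; case: ifP => // _; apply: l0; apply: ltn_trans nN.
  rewrite -(subnKC nN) big_split_ord /= lerDl sumr_ge0// => i _.
  by apply: l0; rewrite -ltn_subRL.
have th0 : 0 <= th by apply: sumr_ge0 => i _; apply: l0; apply: ltn_trans nN.
split.
  have := vd y (d * l n); rewrite mulr_gt0//=.
  have -> : `|y - x| <= d by apply: le_trans IH2 _; rewrite ler_piMr ?(ltW d0)//; lra.
  have -> : d * l n <= d by rewrite ler_piMr ?(ltW d0)//; lra.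
  by move=> /(_ isT isT); rewrite mulrDr; lra.
rewrite addrAC; apply: le_trans (ler_normD _ _) _.
rewrite mulrDr lerD// normrZ ger0_norm ?mulr_ge0 ?(ltW d0) ?(ltW lpos)//.
by rewrite ler_piMr// mulr_ge0 ?(ltW d0) ?(ltW lpos).
Qed.

Variable c : R -> X.
Hypotheses (c_cont : {within `[0, 1], continuous c})
  (c_le : forall t, 0 <= t <= 1 -> Phi (c t) + psi (c t) <= a).

Let low (d s : R) := forall u, 0 <= u <= 1 -> `|u - s| <= d ->
  Phi (c u) + psi (c u) <= a - e * d.
Let good (d s : R) (v : X) := `|v| <= 1 /\
  forall u, 0 <= u <= 1 -> `|u - s| <= d -> forall w t, `|w - c u| <= d ->
    0 < t <= d -> Phi (w + t *: v) - Phi w <= - (2 * e) * t.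

Lemma psi_continuous : continuous psi.
Proof.
move=> x; apply/cvgrPdist_lt => r r0; apply/nbhs_ballP.
exists (r / e) => /=; first by rewrite divr_gt0.
move=> y; rewrite -ball_normE /= ltr_pdivlMr// mulrC => xy.
rewrite ltr_norml; have := psi_lip x y; have := psi_lip y x.
by rewrite (distrC y); lra.
Qed.

Lemma low_near s : 0 <= s <= 1 -> Phi (c s) + psi (c s) < a ->
  exists2 r, 0 < r & forall d s', 0 < d < r -> `|s' - s| < r -> low d s'.
Proof.
move=> s01 sa; pose g x := Phi x + psi x.
have gc : {for c s, continuous g}.
  by apply: cvgD; [exact: Phi_cont|exact: psi_continuous].
(* One half of the gap absorbs the variation of [g], the other half absorbs [e * d]. *)
pose h := (a - g (c s)) / 2.
have h0 : 0 < h by rewrite /h /g; lra.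
have /cvgrPdist_lt/(_ h h0)/nbhs_ballP[r1 /= r10 r1P] := gc.
have [r2 r20 r2P] := (within01P c).1 c_cont s s01 r1 r10.
exists (Num.min (r2 / 2) (h / e)).
  by rewrite lt_min (divr_gt0 r20)// (divr_gt0 h0 e_gt0).
move=> d s'; rewrite !lt_min => /andP[d0 /andP[dr2 dh]] /andP[s'r2 _] u u01 us'.
have : `|u - s| < r2.
  by rewrite -(subrK s' u) -addrA; apply: le_lt_trans (ler_normD _ _) _; lra.
move=> /(r2P _ u01) cu.
have := r1P (c u); rewrite -ball_normE /= distrC => /(_ cu).
rewrite ltr_pdivlMr// in dh; rewrite ltr_norml -/(g (c u)) => /andP[gl _].
by rewrite mulrC; rewrite /h in gl dh; lra.
Qed.

Lemma good_near s v : 0 <= s <= 1 -> `|v| <= 1 ->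
  slope_ub Phi (c s) v (- (2 * e)) ->
  exists2 r, 0 < r & forall d s', 0 < d < r -> `|s' - s| < r -> good d s' v.
Proof.
move=> s01 v1 [[A B] /= [/nbhs_ballP[r1 /= r10 r1A] [r2 /= r20 r2B]] AB].
have r12 : 0 < r1 / 2 by rewrite divr_gt0.
have [r3 r30 r3P] := (within01P c).1 c_cont s s01 _ r12.
exists (Num.min (Num.min (r3 / 2) (r1 / 2)) r2); first by rewrite !lt_min !divr_gt0.
move=> d s'; rewrite !lt_min => /andP[d0 /andP[/andP[dr3 dr1] dr2]].
move=> /andP[/andP[s'r3 _] _]; split => // u u01 us' w t wc /andP[t0 td].
have : `|u - s| < r3.
  by rewrite -(subrK s' u) -addrA; apply: le_lt_trans (ler_normD _ _) _; lra.
move=> /(r3P _ u01) cu.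
apply: (AB (w, t)); split => /=.
  apply: r1A; rewrite -ball_normE /= distrC -(subrK (c u) w) -addrA.
  by apply: le_lt_trans (ler_normD _ _) _; lra.
by apply: r2B => //=; rewrite sub0r normrN gtr0_norm//; lra.
Qed.

(** Around each point one alternative holds at all small scales; compactness of the interval yields
    a common scale. *)
Lemma cover_low_or_good :
  (forall s, 0 <= s <= 1 -> Phi (c s) + psi (c s) = a ->
    exists2 v, `|v| <= 1 & slope_ub Phi (c s) v (- (2 * e))) ->
  \forall n \near \oo, forall s, 0 <= s <= 1 ->
    low n.+1%:R^-1 s \/ exists v, good n.+1%:R^-1 s v.
Proof.
move=> desc.
have /compact_near_coveringP/near_covering_withinP cov := @segment_compact R 0 1.
pose P (n : nat) (s : R) := low n.+1%:R^-1 s \/ exists v, good n.+1%:R^-1 s v.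
have := cov nat \oo P _ _.
suff main : forall s : R, `[0, 1]%classic s ->
    \forall s' \near s & n \near \oo, `[0, 1]%classic s' -> P n s'.
  move=> /(_ _ main); apply: filterS => n nP s s01; apply: nP.
  by rewrite /= in_itv.
move=> s; rewrite /= in_itv /= => s01.
have [r r0 rP] : exists2 r : R, 0 < r & forall d s', 0 < d < r -> `|s' - s| < r ->
    low d s' \/ exists v, good d s' v.
  have := c_le s01; rewrite le_eqVlt => /predU1P[eqa|lta].
    have [v v1 vs] := desc s s01 eqa.
    have [r r0 rP] := good_near s01 v1 vs.
    by exists r => // d s' dr s'r; right; exists v; exact: rP.
  have [r r0 rP] := low_near s01 lta.
  by exists r => // d s' dr s'r; left; exact: rP.
exists (ball s r, [set n : nat | n.+1%:R^-1 < r]).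
  split => /=; first exact: nbhsx_ballx.
  exact: near_infty_natSinv_lt (PosNum r0).
move=> [s' n] /= [s'r nr] _; apply: rP; last by move: s'r; rewrite -ball_normE /= distrC.
by rewrite invr_gt0 ltr0Sn.
Qed.

(** Hats of mesh [d] glue the directions chosen at the nodes, with [h = d]. If a low node is active
    at [t], the old value already lies below [a - e * d] and must only not increase. Otherwise the
    good nodes have total weight 1, and [Phi] drops by [2 * e * d] while [psi] gains at most
    [e * d]. *)
Lemma path_descent :
  Phi (c 0) + psi (c 0) < a -> Phi (c 1) + psi (c 1) < a ->
  (forall s, 0 <= s <= 1 -> Phi (c s) + psi (c s) = a ->
    exists2 v, `|v| <= 1 & slope_ub Phi (c s) v (- (2 * e))) ->
  exists (c' : R -> X) (h : R), [/\ 0 < h, {within `[0, 1], continuous c'},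
    c' 0 = c 0, c' 1 = c 1 &
    forall t, 0 <= t <= 1 -> [/\ Phi (c' t) <= Phi (c t),
      Phi (c' t) + psi (c' t) <= a - e * h & `|c' t - c t| <= h]].
Proof.
move=> c0a c1a desc.
have i0 : (0 : R) <= (0 : R) <= 1 by rewrite lexx ler01.
have i1 : (0 : R) <= (1 : R) <= 1 by rewrite lexx ler01.
have [r0 r0_gt0 r0P] := low_near i0 c0a.
have [r1 r1_gt0 r1P] := low_near i1 c1a.
have [n [[nr0 nr1] cov]] := filter_ex (filterI (filterI
  (near_infty_natSinv_lt (PosNum r0_gt0)) (near_infty_natSinv_lt (PosNum r1_gt0)))
  (cover_low_or_good desc)).
rewrite /= in nr0 nr1.
set N := n.+1 in nr0 nr1 cov; set d := N%:R^-1 in nr0 nr1 cov.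
have d0 : 0 < d by rewrite invr_gt0 ltr0Sn.
have Nn0 : N%:R != 0 :> R by rewrite pnatr_eq0.
have low0 : low d 0 by apply: r0P; rewrite ?d0// subrr normr0.
have low1 : low d 1 by apply: r1P; rewrite ?d0// subrr normr0.
pose node (i : nat) : R := i%:R * d.
pose lowb i := `[< low d (node i) >].
(* Low nodes do not move the path; both end nodes are low, which fixes the endpoints. *)
pose v i := if lowb i then 0 else xget 0 (good d (node i)).
have vlow i : lowb i -> v i = 0 by rewrite /v => ->.
have vgood i : (i < N.+1)%N -> ~~ lowb i -> good d (node i) (v i).
  move=> iN ni; rewrite /v (negbTE ni).
  have /cov[li|[w wg]] : 0 <= node i <= 1.
      by rewrite /node mulr_ge0 ?(ltW d0)//= /d ler_pdivrMr ?ltr0Sn// mul1r ler_nat.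
    by move: ni; rewrite /lowb => /asboolP.
  by apply: xgetI wg.
have hat_near i t : hat N i t != 0 -> `|t - node i| < d.
  move=> /hat_supp; rewrite -[d]mul1r -ltr_pdivrMr// /d invrK.
  by rewrite -{2}(ger0_norm (ler0n R N)) -normrM mulrBl -mulrA mulVf// mulr1 (mulrC t).
pose c' t := c t + d *: \sum_(k < N.+1) hat N k t *: v k.
have descent t : 0 <= t <= 1 ->
    let th := \sum_(k < N.+1 | ~~ lowb k) hat N k t in
    Phi (c' t) <= Phi (c t) - 2 * e * d * th /\ `|c' t - c t| <= d * th.
  move=> t01; apply: (descent_along_sum (l := fun k => hat N k t) (v := v)) => //.
  - by move=> k _; exact: hat_ge0.
  - by rewrite sum_hat.
  - move=> k kN nk /hat_near/ltW tk; have [v1 vd] := vgood k kN nk.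
    by split => // w s; apply: vd.
have fixed t : (forall i, hat N i t != 0 -> lowb i) -> c' t = c t.
  move=> H; rewrite /c' big1 ?scaler0 ?addr0// => k _.
  have [->|/H/vlow ->] := eqVneq (hat N k t) 0; [exact: scale0r|exact: scaler0].
exists c', d; split => //.
- rewrite subspace_continuousP => t t01; apply: cvgD.
    by have /subspace_continuousP := c_cont; exact.
  apply: cvgZl_tmp; apply: cvg_within_filter; exact: sum_hat_continuous.
- apply: fixed => -[|i] /hat_supp; first by rewrite /lowb /node mul0r => _; apply/asboolP.
  rewrite mulr0 sub0r normrN ger0_norm// -natr1.
  by have := ler0n R i; lra.
(* At [t = 1] only the hat of the last node [N] is nonzero. *)
- apply: fixed => i /hat_supp; rewrite mulr1 => iN.
  have -> : i = N.
    move: iN; rewrite ltr_norml => iN.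
    apply/eqP; rewrite eqn_leq -ltnS -(ltr_nat R) -(natr1 N).
    by rewrite -[(N <= i)%N]ltnS -(ltr_nat R) -(natr1 i); lra.
  by rewrite /lowb /node mulfV//; apply/asboolP.
- move=> t t01; have [] := descent t t01; set th := \sum_(k < _ | _) _ => D1 D2.
  have th0 : 0 <= th by apply: sumr_ge0 => k _; exact: hat_ge0.
  have th1 : th <= 1.
    rewrite -(sum_hat N t01) /th big_mkcond /=; apply: ler_sum => k _.
    by case: ifP => // _; exact: hat_ge0.
  have edth : 0 <= e * d * th by rewrite !mulr_ge0// ltW.
  have D3 : Phi (c' t) + psi (c' t) <= Phi (c t) + psi (c t) - e * d * th.
    have := psi_lip (c' t) (c t).
    have : e * `|c' t - c t| <= e * (d * th) by rewrite ler_wpM2l ?(ltW e_gt0).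
    by lra.
  split; [by lra| |by apply: le_trans D2 _; rewrite ler_piMr// ltW].
  have [[k [kN hk lk]]|nolow] := pselect (exists k,
      [/\ (k < N.+1)%N, hat N k t != 0 & lowb k]).
    move: lk => /asboolP/(_ t t01 (ltW (hat_near _ _ hk))); lra.
  have thE : th = 1.
    rewrite -(sum_hat N t01) /th big_mkcond; apply: eq_bigr => k _.
    case: ifPn => // /negPn lk; apply/esym/eqP; apply: contrapT => /negP hk.
    by apply: nolow; exists k.
  by rewrite thE in D3; have := c_le t01; lra.
Qed.

End Perturbation.

(** * The distance to a set *)

Section Distance.
Variables (R : realType) (X : normedModType R).
Implicit Types (x y z : X) (F : set X).

Let dist_lb F x : has_lbound [set `|x - y| | y in F].
Proof. by exists 0 => _ [y _ <-]. Qed.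

Lemma dist_le F x y : F y -> dist x F <= `|x - y|.
Proof. by move=> Fy; apply: ge_inf => //; exists y. Qed.

Lemma dist_ge0 F x : 0 <= dist x F.
Proof.
have [[y Fy]|F0] := pselect (F !=set0).
  by apply: lb_le_inf; [exists `|x - y|, y|move=> _ [z _ <-]].
rewrite /dist (_ : [set _ | _ in _] = set0) ?inf0//.
by rewrite -subset0 => r [y Fy _]; apply: F0; exists y.
Qed.

Lemma dist_lipschitz F x y : F !=set0 -> dist x F <= dist y F + `|x - y|.
Proof.
move=> [z Fz]; rewrite -lerBlDr; apply: lb_le_inf; first by exists `|y - z|, z.
move=> _ [u Fu <-]; rewrite lerBlDr; apply: le_trans (dist_le x Fu) _.
by rewrite [leRHS]addrC -{1}(subrK y x) -addrA ler_normD.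
Qed.

Lemma dist_lt F x r : F !=set0 -> dist x F < r -> exists2 y, F y & `|x - y| < r.
Proof.
move=> [z Fz] /inf_lt; case=> [|_ [y Fy <-] xy]; first by exists `|x - z|, z.
by exists y.
Qed.

Lemma dist_gt0 F x : F !=set0 -> closed F -> ~ F x -> 0 < dist x F.
Proof.
move=> F0 cF nFx; have /nbhs_ballP[r /= r0 rF] : nbhs x (~` F).
  by apply: open_nbhs_nbhs; split => //; exact: closed_openC.
apply: lt_le_trans r0 _; rewrite leNgt; apply/negP => /(dist_lt F0)[y Fy xy].
by apply: (rF y) Fy; rewrite -ball_normE.
Qed.

End Distance.

(** * Paths and the minimax value *)

Section Minimax.
Variables (R : realType) (X : normedModType R) (Phi : X -> R) (z0 z1 : X).
Hypothesis Phi_cont : continuous Phi.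

Let gamma := minimax Phi z0 z1.

(** A path avoiding [H] would have a connected image in the complement, joining [z0] to [z1]. *)
Lemma path_hits (H : set X) c : separates H z0 z1 -> paths z0 z1 c ->
  exists2 t, 0 <= t <= 1 & H (c t).
Proof.
move=> [_ nH0 nH1 comp] [cc c0 c1]; apply: contrapT => nohit; apply: comp.
apply: same_connected_component.
exists (c @` `[0, 1]); last by exists 1; rewrite //= in_itv /= lexx ler01.
split.
- by exists 0; rewrite //= in_itv /= lexx ler01.
- move=> _ [t t01 <-] Hct; by apply: nohit; exists t.
- apply: connected_continuous_connected => //.
  exact/connected_intervalP/interval_is_interval.
Qed.

(** The extreme value theorem ensures that [set_max] is a true maximum and not its default value. *)
Lemma path_max (c : R -> X) : {within `[0, 1], continuous c} ->
  exists t, [/\ 0 <= t <= 1, set_max [set Phi (c t) | t in `[0, 1]] = Phi (c t) &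
    forall s, 0 <= s <= 1 -> Phi (c s) <= Phi (c t)].
Proof.
move=> cc.
have Pc : {within `[0, 1], continuous (Phi \o c)}.
  move/subspace_continuousP : cc => cc; apply/subspace_continuousP => t t01 A.
  by move=> /Phi_cont /(cc t t01).
have [t t01 tmax] := EVT_max ler01 Pc.
have t01' : 0 <= t <= 1 by move: t01; rewrite in_itv.
exists t; split => //.
apply: set_maxE; first by exists t.
by move=> _ [s s01 <-]; apply: tmax.
Qed.

Let maxima := [set set_max [set Phi (c t) | t in `[0, 1]] | c in paths z0 z1].

Lemma segment_path : paths z0 z1 (fun t : R => z0 + t *: (z1 - z0)).
Proof.
split; last 2 first.
- by rewrite scale0r addr0.
- by rewrite scale1r addrC subrK.
apply: continuous_subspaceT => t.
by apply: cvgD; [exact: cvg_cst|apply: cvgZr_tmp; exact: cvg_id].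
Qed.

Let maxima_neq0 : maxima !=set0.
Proof. by eexists; eexists; [exact: segment_path|reflexivity]. Qed.

Let maxima_ge t (m : R) : 0 <= t <= 1 ->
  (forall c, paths z0 z1 c -> m <= Phi (c t)) -> lbound maxima m.
Proof.
move=> t01 mP _ [c pc <-]; have [cc _ _] := pc.
have [s [s01 -> smax]] := path_max cc.
exact: le_trans (mP c pc) (smax _ t01).
Qed.

Let zero_in : (0 : R) <= (0 : R) <= 1. Proof. by rewrite lexx ler01. Qed.
Let one_in : (0 : R) <= (1 : R) <= 1. Proof. by rewrite lexx ler01. Qed.

Lemma minimax_ge_endpoints : Phi z0 <= gamma /\ Phi z1 <= gamma.
Proof.
by split; apply: lb_le_inf maxima_neq0 _;
  [apply: maxima_ge zero_in _|apply: maxima_ge one_in _] => c [_ c0 c1];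
  rewrite ?c0 ?c1.
Qed.

Lemma almost_minimal_path r : 0 < r ->
  exists2 c, paths z0 z1 c & forall t, 0 <= t <= 1 -> Phi (c t) <= gamma + r.
Proof.
move=> r0; have hi : has_inf maxima.
  split; first exact: maxima_neq0.
  by exists (Phi z0); apply: (maxima_ge zero_in) => c [_ -> _].
have [_ [c pc <-] cr] := inf_adherent r0 hi.
exists c => // t t01; have [cc _ _] := pc.
have [s [s01 sE smax]] := path_max cc.
by apply: le_trans (smax _ t01) _; rewrite -sE; exact: ltW.
Qed.

End Minimax.

(** * Uniform limits of paths *)

Section UniformLimit.
Variables (R : realType) (X : completeNormedModType R).

(** The increments are dominated by those of a convergent real sequence, so completeness applies;
    letting [n] tend to infinity gives the rate. *)
Lemma cauchy_dominated (f : nat -> X) (a : nat -> R) (l : R) :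
  a @ \oo --> l -> (forall m n, (m <= n)%N -> `|f n - f m| <= a m - a n) ->
  exists2 y, f @ \oo --> y & forall m, `|y - f m| <= a m - l.
Proof.
move=> al fa.
have /cvg_ex[y fy] : cvgn f.
  apply/cauchy_cvgP; apply: cauchy_exP => r r0.
  have r2 : 0 < r / 2 by rewrite divr_gt0.
  have /cvgrPdist_lt/(_ _ r2)[N _ NP] := al.
  exists (f N); exists N => // n /= Nn; rewrite -ball_normE /= distrC.
  apply: le_lt_trans (fa _ _ Nn) _.
  have := NP N (leqnn N); have := NP n Nn; rewrite /= !ltr_norml; lra.
exists y => // m.
apply: (ler_cvg_to (f := fun n => `|f n - f m|) (g := fun n => a m - a n)
  (a := \oo)).
- by apply: cvg_norm; apply: cvgB fy _; exact: cvg_cst.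
- by apply: cvgB => //; exact: cvg_cst.
- by exists m => // n /= mn; exact: fa.
Qed.

(** The rate does not depend on [t], so a three-epsilon argument makes the limit continuous. *)
Lemma path_cauchy_dominated (f : nat -> R -> X) (a : nat -> R) (l : R) :
  a @ \oo --> l -> (forall n, {within `[0, 1], continuous (f n)}) ->
  (forall m n t, (m <= n)%N -> 0 <= t <= 1 -> `|f n t - f m t| <= a m - a n) ->
  exists c : R -> X, [/\ {within `[0, 1], continuous c},
    forall t, 0 <= t <= 1 -> f ^~ t @ \oo --> c t &
    forall m t, 0 <= t <= 1 -> `|c t - f m t| <= a m - l].
Proof.
move=> al fc fa.
have /choice[c cP] t : exists y, 0 <= t <= 1 -> f ^~ t @ \oo --> y /\
    forall m, `|y - f m t| <= a m - l.
  have [t01|] := boolP (0 <= t <= 1); last by exists 0.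
  have [y fy ym] := cauchy_dominated al (fun m n mn => fa m n t mn t01).
  by exists y.
exists c; split; [|by move=> t /cP[]|by move=> m t /cP[]].
apply/within01P => s s01 r r0.
have r3 : 0 < r / 3 by rewrite divr_gt0.
have /cvgrPdist_lt/(_ _ r3)[N _ NP] := al.
have aN : a N - l < r / 3.
  by have := NP N (leqnn N); rewrite /= ltr_norml; lra.
have [d d0 dP] := (within01P (f N)).1 (fc N) s s01 _ r3.
exists d => // u u01 us.
have -> : c u - c s = (c u - f N u) + (f N u - f N s) - (c s - f N s).
  by rewrite opprB !subrKA.
have := dP u u01 us.
have := (cP u u01).2 N; have := (cP s s01).2 N.
have := ler_normB (c u - f N u + (f N u - f N s)) (c s - f N s).
have := ler_normD (c u - f N u) (f N u - f N s).
lra.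
Qed.

End UniformLimit.

(** * Almost critical points near the separating set *)

Section AlmostCritical.
Variables (R : realType) (X : completeNormedModType R) (Phi : X -> R)
  (z0 z1 : X) (H : set X).
Hypothesis Phi_cont : continuous Phi.

Let gamma := minimax Phi z0 z1.

Hypotheses (H_sep : separates H z0 z1) (H_ge : forall x, H x -> gamma <= Phi x).

Variable e : R.
Hypothesis e_gt0 : 0 < e.

Let psi x := Num.max 0 (e ^+ 2 - e * dist x H).
(** Half the height of [psi]: where [Phi + psi] reaches [gamma + e ^+ 2], [Phi <= M] forces
    [psi > 0]. *)
Let M := gamma + e ^+ 2 / 2.

Let e2 : 0 < e ^+ 2. Proof. by rewrite exprn_gt0. Qed.

Let H_neq0 : H !=set0.
Proof.
have [t _ Ht] := path_hits H_sep (segment_path z0 z1).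
by eexists; exact: Ht.
Qed.

Let psi_le x : psi x <= e ^+ 2.
Proof.
rewrite ge_max (ltW e2)/= gerBl mulr_ge0 ?(ltW e_gt0)//; exact: dist_ge0.
Qed.

Let psi_H x : H x -> psi x = e ^+ 2.
Proof.
move=> Hx; have := dist_le x Hx; rewrite subrr normr0 => d0.
have -> : psi x = Num.max 0 (e ^+ 2 - e * 0).
  by congr Num.max; congr (_ - e * _); apply/eqP; rewrite eq_le d0 dist_ge0.
by rewrite mulr0 subr0 max_r// ltW.
Qed.

Let psi_lip x y : psi x <= psi y + e * `|x - y|.
Proof.
have n0 : 0 <= e * `|x - y| by rewrite mulr_ge0// ltW.
rewrite ge_max; apply/andP; split.
  by apply: addr_ge0 => //; rewrite le_max lexx.
have : e * dist y H <= e * (dist x H + `|x - y|).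
  by rewrite ler_wpM2l ?(ltW e_gt0)// distrC dist_lipschitz.
have : e ^+ 2 - e * dist y H <= psi y by rewrite le_max lexx orbT.
by rewrite mulrDr; lra.
Qed.

(** Closedness of [H] puts [psi z] strictly below its peak; this gap allows the deformation to fix
    the endpoints. *)
Let psi_endpoint z : ~ H z -> Phi z <= gamma -> Phi z + psi z < gamma + e ^+ 2.
Proof.
move=> nHz zg; have [cH _ _ _] := H_sep.
have dz : 0 < dist z H by exact: dist_gt0.
apply: ler_ltD => //; rewrite gt_max e2/= gtrBl; exact: mulr_gt0.
Qed.

Let admissible (p : (R -> X) * R) : Prop :=
  [/\ paths z0 z1 p.1, forall t, 0 <= t <= 1 -> Phi (p.1 t) <= M &
    forall t, 0 <= t <= 1 -> Phi (p.1 t) + psi (p.1 t) <= p.2].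

Let bound_ge p : admissible p -> gamma + e ^+ 2 <= p.2.
Proof.
move=> [pp _ pb]; have [t t01 Ht] := path_hits H_sep pp.
by have := pb t t01; rewrite psi_H//; have := H_ge Ht; lra.
Qed.

(* The second component bounds [Phi + psi] on the path and stands for its
   maximum. *)
Let state := {p : (R -> X) * R | admissible p}.
(** Ekeland's order in the uniform norm: a displacement [h] costs a decrease of the bound by at
    least [e * h]. *)
Let le (q p : state) : Prop := forall t, 0 <= t <= 1 ->
  e * `|(sval q).1 t - (sval p).1 t| <= (sval p).2 - (sval q).2.

Let zero_in : (0 : R) <= (0 : R) <= 1. Proof. by rewrite lexx ler01. Qed.

Let le_bound p q : le q p -> (sval q).2 <= (sval p).2.
Proof.
move=> /(_ 0 zero_in) qp; rewrite -subr_ge0; apply: le_trans qp.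
by rewrite mulr_ge0// ltW.
Qed.

Let le_refl_state p : le p p.
Proof. by move=> t _; rewrite !subrr normr0 mulr0. Qed.

Let le_trans_state q p r : le p q -> le q r -> le p r.
Proof.
move=> pq qr t t01; have := pq t t01; have := qr t t01.
have : e * `|(sval p).1 t - (sval r).1 t| <=
    e * (`|(sval p).1 t - (sval q).1 t| + `|(sval q).1 t - (sval r).1 t|).
  rewrite ler_wpM2l ?(ltW e_gt0)//.
  by rewrite -{1}(subrKA ((sval q).1 t)) ler_normD.
by rewrite mulrDr; lra.
Qed.

(** The decreasing bounds converge and dominate the displacements, so the paths converge uniformly;
    admissibility passes to the limit pointwise. *)
Let le_seq_lb (u : nat -> state) : (forall n, le (u n.+1) (u n)) ->
  exists x, forall n, le x (u n).
Proof.
move=> uS; pose a n := (sval (u n)).2; pose f n := (sval (u n)).1.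
have umn m n : (m <= n)%N -> le (u n) (u m).
  elim: n => [|n IH]; first by rewrite leqn0 => /eqP ->; exact: le_refl_state.
  rewrite leq_eqVlt => /predU1P[->|mn]; first exact: le_refl_state.
  exact: le_trans_state (uS n) (IH mn).
have a_lb : has_lbound (range a).
  by exists (gamma + e ^+ 2) => _ [n _ <-]; apply: bound_ge; exact: svalP.
have al : a @ \oo --> inf (range a).
  by apply: nonincreasing_cvgn => // m n mn; apply: le_bound; exact: umn.
set l := inf _ in al.
have ael : (fun n => a n / e) @ \oo --> l / e by exact: cvgMr_tmp.
have fc n : {within `[0, 1], continuous (f n)} by case: (svalP (u n)) => -[].
have fa m n t : (m <= n)%N -> 0 <= t <= 1 -> `|f n t - f m t| <= a m / e - a n / e.
  by move=> mn t01; rewrite -mulrBl ler_pdivlMr// mulrC; exact: umn.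
have [c [cc cf cm]] := path_cauchy_dominated ael fc fa.
have Phif t : 0 <= t <= 1 -> Phi (f n t) @[n --> \oo] --> Phi (c t).
  by move=> t01; apply: continuous_cvg; [exact: Phi_cont|exact: cf].
have psif t : 0 <= t <= 1 -> psi (f n t) @[n --> \oo] --> psi (c t).
  move=> t01; apply: continuous_cvg; last exact: cf.
  exact: (psi_continuous e_gt0 psi_lip).
have one_in : (0 : R) <= (1 : R) <= 1 by rewrite lexx ler01.
have fixed t z : 0 <= t <= 1 -> (forall n, f n t = z) -> c t = z.
  move=> t01 fz; have fE : f ^~ t = cst z by apply/funext => n; exact: fz.
  have := cf t t01; rewrite fE => cz.
  exact: norm_cvg_unique cz (cvg_cst _).
have adm : admissible (c, l).
  split => /=.
  - by split => //; apply: fixed => // n; case: (svalP (u n)) => -[].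
  - move=> t t01; apply: cvgr_to_le (Phif t t01) _.
    by apply: nearW => n; case: (svalP (u n)) => _ + _; exact.
  - move=> t t01; apply: ler_cvg_to (cvgD (Phif t t01) (psif t t01)) al _.
    by apply: nearW => n; case: (svalP (u n)) => _ _; exact.
exists (exist _ _ adm) => n t t01 /=.
by have := cm n t t01; rewrite -mulrBl ler_pdivlMr// mulrC.
Qed.

Lemma almost_critical_point : exists x, [/\ exists2 y, H y & `|x - y| < e,
  gamma <= Phi x <= gamma + e ^+ 2 / 2 &
  forall v, `|v| <= 1 -> ~ slope_ub Phi x v (- (2 * e))].
Proof.
apply: contrapT => nocrit.
have [c0 pc0 c0M] : exists2 c, paths z0 z1 c & forall t, 0 <= t <= 1 -> Phi (c t) <= M.
  by apply: almost_minimal_path => //; rewrite divr_gt0.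
have adm0 : admissible (c0, M + e ^+ 2).
  by split => //= t t01; apply: lerD; [exact: c0M|exact: psi_le].
have [[[c a] adm] [_ cmin]] := brezis_browder (I := fun p : state => (sval p).2)
  le_refl_state le_trans_state le_bound
  (fun p => bound_ge (svalP p)) le_seq_lb (exist _ _ adm0).
have [[cc c0E c1E] cM ca] := adm; have := bound_ge adm.
rewrite /= in cc c0E c1E cM ca * => a_ge.
have [_ nH0 nH1 _] := H_sep.
have [g0 g1] := minimax_ge_endpoints z0 z1 Phi_cont.
have := path_descent Phi_cont e_gt0 psi_lip cc ca; case.
- by rewrite c0E; apply: lt_le_trans a_ge; exact: psi_endpoint.
- by rewrite c1E; apply: lt_le_trans a_ge; exact: psi_endpoint.
- move=> s s01 sa; apply: contrapT => nv; apply: nocrit; exists (c s).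
  have := cM s s01; have := psi_le (c s); rewrite /M => pe PM; split.
  + apply: dist_lt => //; rewrite ltNge; apply/negP => ed.
    have psi0 : psi (c s) = 0.
      rewrite /psi max_l// subr_le0 expr2 ler_wpM2l// ltW//.
    by have := e2; move: sa; rewrite psi0; lra.
  (* The lower bound holds because [Phi + psi] equals [a], at least [gamma + e ^+ 2], and [psi] is
     at most [e ^+ 2]. *)
  + by apply/andP; split => //; lra.
  + by move=> v v1 vs; apply: nv; exists v.
move=> c' [h [h0 c'c c'0 c'1 c'P]].
have adm' : admissible (c', a - e * h).
  split => /=.
  - by split => //; rewrite ?c'0 ?c'1.
  - by move=> t t01; have [+ _ _] := c'P t t01; move/le_trans; apply; exact: cM.
  - by move=> t /c'P[].
have := cmin (exist _ _ adm'); rewrite /=.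
have eh : 0 < e * h by rewrite mulr_gt0.
(* The deformed path lies below the minimal state, yet its bound is smaller by [e * h]. *)
suff : le (exist _ _ adm') (exist _ _ adm) by move=> /[swap] /[apply]; lra.
move=> t t01 /=; have [_ _ ch] := c'P t t01.
by rewrite opprB addrCA subrr addr0 ler_wpM2l// ltW.
Qed.

End AlmostCritical.

(** * Passage to the limit under the compactness condition *)

Lemma locally_lipschitz_continuous (R : realType) (X : normedModType R)
    (Phi : X -> R) : locally_lipschitz Phi -> continuous Phi.
Proof.
move=> LPhi x; have [U Ux /pinfty_ex_gt0[L L0 LU]] := LPhi x.
apply/cvgrPdist_lt => r r0.
have : \forall y \near x, `|x - y| < r / L.
  by apply/nbhs_ballP; exists (r / L) => /=; [rewrite divr_gt0|rewrite -ball_normE].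
move=> /(filterI Ux); apply: filterS => y [Uy xy].
apply: le_lt_trans (LU (x, y) _) _; first by split => //; exact: nbhs_singleton.
by rewrite mulrC -ltr_pdivlMr.
Qed.

(** If [r] were below [- (e * |v|)], scaling [v] by [e / - r] would give a vector in the unit ball
    with slope exactly [- e]. *)
Lemma slope_ub_ge (R : realType) (X : normedModType R) (Phi : X -> R) (x : X)
    (e : R) : 0 < e ->
  (forall v, `|v| <= 1 -> ~ slope_ub Phi x v (- e)) ->
  forall v r, slope_ub Phi x v r -> - (e * `|v|) <= r.
Proof.
move=> e0 nslope v r vr; rewrite leNgt; apply/negP => rlt.
have ev0 : 0 <= e * `|v| by rewrite mulr_ge0// ltW.
have r0 : 0 < - r by lra.
have s0 : 0 < e / - r by rewrite divr_gt0.
apply: (nslope ((e / - r) *: v)).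
  rewrite normrZ gtr0_norm// mulrAC ler_pdivrMr// mul1r; lra.
have := slope_ubZ s0 vr.
by rewrite invrN mulrN mulNr -mulrA mulVf ?mulr1// lt_eqF//; lra.
Qed.

Theorem theorem1p11 (R : realType) (X : completeNormedModType R)
    (Phi : X -> R) (z0 z1 : X) (F : set X) :
  locally_lipschitz Phi ->
  closed F ->
  bounded_set F ->
  separates (F `&` superlevel Phi (minimax Phi z0 z1)) z0 z1 ->
  CPS Phi F (minimax Phi z0 z1) ->
  exists xbar : X,
    [/\ F xbar, Phi xbar = minimax Phi z0 z1
      & clarke_gradient Phi xbar (\0 : {linear X -> R^o})].
Proof.
move=> LPhi cF bF sep cps; have Phi_cont := locally_lipschitz_continuous LPhi.
set gamma := minimax Phi z0 z1 in sep cps *.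
set H := F `&` _ in sep.
have H_ge x : H x -> gamma <= Phi x by case.
pose e (n : nat) : R := harmonic n.
have e0 n : 0 < e n by rewrite invr_gt0.
have e1 n : e n <= 1 by rewrite invf_le1 ?ler1n.
have ecvg : e @ \oo --> (0 : R) by exact: cvg_harmonic.
have /choice[x xP] n := almost_critical_point Phi_cont sep H_ge (e0 n).
have near_F n : exists y, F y /\ `|x n - y| < e n.
  by have [[y [Fy _] xy] _ _] := xP n; exists y.
have slope n v r : slope_ub Phi (x n) v r -> - (2 * e n * `|v|) <= r.
  have [_ _ nslope] := xP n.
  by apply: slope_ub_ge => //; rewrite mulr_gt0.
have Phi_close n : gamma <= Phi (x n) <= gamma + e n.
  have [_ /andP[-> xe] _] := xP n; apply: le_trans xe _; rewrite lerD2l.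
  have : e n ^+ 2 <= e n by rewrite expr2 ler_piMl// ltW.
  by have := e0 n; lra.
have gcvg : gamma + e n @[n --> \oo] --> gamma.
  by rewrite -[X in _ --> X]addr0; apply: cvgD => //; exact: cvg_cst.
have Phi_cvg : Phi (x n) @[n --> \oo] --> gamma.
  apply: squeeze_cvgr gcvg; last exact: cvg_cst.
  by apply: nearW => n; exact: Phi_close.
have [B B0 /= FB] : exists2 B : R, 0 < B & forall y, F y -> `|y| < B.
  by have [B B0 FB] := ex_strict_bound_gt0 bF; exists B.
have [phi [phi_incr /cvg_ex[/= xbar xcvg]]] : exists phi : nat -> nat,
    increasing_seq phi /\ cvgn (x \o phi).
  apply: cps => //.
  - apply: (squeeze_cvgr (f := fun=> 0) (h := e)) => //; last exact: cvg_cst.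
    apply: nearW => n; rewrite dist_ge0/=; have [y [Fy xy]] := near_F n.
    by apply: le_trans (dist_le _ Fy) _; exact: ltW.
  (* The weight is at most [2 + B], as [x n] is within 1 of a point of [F]; the least subgradient
     norm is at most [2 * e n]. *)
  - apply: (squeeze_cvgr (f := fun=> 0) (h := fun n => (2 + B) * 2 * e n)).
    + apply: nearW => n.
      have en2 : 0 <= 2 * e n by rewrite mulr_ge0// ltW.
      have /andP[m0 m1] := min_dual_norm_le en2 (slope n).
      rewrite mulr_ge0 ?addr_ge0//= -mulrA ler_pM ?addr_ge0//.
      have [y [Fy xy]] := near_F n; have := FB y Fy; have := e1 n.
      by have := ler_normD (x n - y) y; rewrite subrK; lra.
    + exact: cvg_cst.
    + by rewrite -[X in _ --> X](mulr0 ((2 + B) * 2)); exact: cvgMl_tmp.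
have phi_ge n : (n <= phi n)%N.
  elim: n => [//|n IH]; apply: leq_ltn_trans IH _.
  by rewrite (leqW_mono phi_incr).
have phi_cvg : phi @ \oo --> \oo.
  move=> A [N _ NA]; exists N => // n /= Nn; apply: NA => /=.
  exact: leq_trans Nn (phi_ge n).
have ephi_cvg : e (phi n) @[n --> \oo] --> (0 : R) by exact: cvg_comp phi_cvg ecvg.
exists xbar; split.
(* The nearby points of the closed set [F] converge to [xbar] as well. *)
- have /choice[y yP] n := near_F (phi n).
  apply: (closed_cvg _ cF (u_ := y) (F := \oo)).
    by apply: nearW => n; case: (yP n).
  apply/cvgrPdist_lt => r r0; have r2 : 0 < r / 2 by rewrite divr_gt0.
  near=> n.
  have xn : `|xbar - x (phi n)| < r / 2.
    by near: n; move/cvgrPdist_lt: xcvg; exact.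
  have en : e (phi n) < r / 2.
    by near: n; exact: (cvgr_lt _ ephi_cvg).
  have [_ yn] := yP n.
  rewrite -(subrKA (x (phi n))); apply: le_lt_trans (ler_normD _ _) _; lra.
- have xPhi : Phi (x (phi n)) @[n --> \oo] --> Phi xbar.
    by apply: continuous_cvg => //; exact: Phi_cont.
  exact: norm_cvg_unique xPhi (cvg_comp _ _ phi_cvg Phi_cvg).
- split; first exact: cst_continuous.
  move=> v; apply: slope_ub_le_clarke => r vr; rewrite leNgt; apply/negP => /= r0.
  (* A negative slope bound [r] at [xbar] would persist at [x (phi n)] for large [n], where slopes
     along [v] are at least [- (2 * e (phi n) * |v|)]. *)
  have small : \forall n \near \oo, 2 * e (phi n) * `|v| < - r.
    have : 2 * e (phi n) * `|v| @[n --> \oo] --> (0 : R).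
      have -> : (0 : R) = 2 * 0 * `|v| by rewrite mulr0 mul0r.
      by apply: cvgMr_tmp; exact: cvgMl_tmp.
    by move=> /cvgr_lt; apply; lra.
  have [n [/= sn /slope]] := filter_ex (filterI small (xcvg _ (slope_ub_near vr))).
  by lra.
Unshelve. all: by end_near. Qed.
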